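(* Let $d\ge1$ be an integer, let $\mathcal G$ be a graph class of copying shrub-depth $d$, and let $\tau$ be a $\mathrm{CMSO}_1$ transduction. Then the copying shrub-depth of $\tau(\mathcal G)$ is at most $d$, i.e., $\tau(\mathcal G)\subseteq\mathrm{TMC}_d^{m',k'}$ for some $m',k'$.
   Context: All graphs are finite, simple and undirected. A tree-model of $m$ colours and depth $d$ of a graph $G$ is a rooted tree $T$ with a set $S\subseteq\{1,\dots,m\}^2\times\{1,\dots,d\}$ such that: every root-to-leaf path has length exactly $d$; the leaves are exactly $V(G)$; each leaf gets one of colours $1,\dots,m$; $(i,j,\ell)\in S$ iff $(j,i,\ell)\in S$; and for distinct $u,v\in V(G)$ coloured $i,j$ at distance $2\ell$ in $T$, $uv\in E(G)$ iff $(i,j,\ell)\in S$. A graph $G$ has a $k$-copied tree-model of $m$ colours and depth $d$ if $G$ has a tree-model of $m$ colours and depth $d+1$ in which every node at distance $d$ from the root has at most $k$ leaf descendants; $\mathrm{TMC}_d^{m,k}$ is the class of such graphs. A class $\mathcal G$ has copying shrub-depth $d$ if $\mathcal G\subseteq\mathrm{TMC}_d^{m,k}$ for some $m,k$ but $\mathcal G\not\subseteq \mathrm{TMC}_{d-1}^{m',k'}$ for all $m',k'$; copying shrub-depth at most $d$ means $\mathcal G\subseteq\mathrm{TMC}_d^{m,k}$ for some $m,k$. $\mathrm{CMSO}_1$ logic over relational structures: element and set variables, equality, quantifiers over elements and sets, Boolean connectives, membership, the relation symbols, and predicates $\mathrm{mod}_{a,b}(X)$ holding iff $|X|\bmod b=a$.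 A basic $\mathrm{CMSO}_1$ graph transduction $(\chi,\nu,\mu)$ ($\chi$ a sentence, $\nu$ with one and $\mu$ with two free element variables, $\mu$ symmetric) maps a structure $A$ with $A\models\chi$ to the graph with vertices $\{v:A\models\nu(v)\}$ and edges $\{u,v\}$, $u\neq v$, with $A\models\nu(u)\wedge\nu(v)\wedge\mu(u,v)$ (undefined if $A\not\models\chi$). The expansion by $p$ unary predicates maps a (labelled) graph $G$ to the set of all its expansions by $p$ new arbitrary unary predicates. The $k$-copy operation maps such a structure $G$ to the structure $G^{\times k}$ with universe $V(G)\times\{1,\dots,k\}$ in which each $V(G)\times\{i\}$ carries a copy of $G$ (edges and unary predicates), there are no edges between distinct copies, and there are additional relations $\sim$ with $(u,i)\sim(v,j)$ iff $u=v$, and unary $P_i=V(G)\times\{i\}$. A $\mathrm{CMSO}_1$ transduction is a composition $\tau=\tau_1\circ\gamma\circ\varepsilon$ with $\varepsilon$ an expansion by some $p$ unary predicates, $\gamma$ a $k$-copy operation for some $k$, and $\tau_1$ a basic $\mathrm{CMSO}_1$ graph transduction; $\tau(\mathcal G)=\bigcup_{G\in\mathcal G}\tau(G)$. *)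

(* Defs.v *)
From HB Require Import structures.
From mathcomp Require Import all_boot.

Set Implicit Arguments.
Unset Strict Implicit.
Unset Printing Implicit Defensive.

Record sgraph := SGraph {
  vertex :> finType;
  edge : rel vertex;
  edge_sym : symmetric edge;
  edge_irrefl : irreflexive edge }.

Definition graph_iso (G H : sgraph) : Prop :=
  exists2 f : G -> H, bijective f & {mono f : u v / edge u v}.

Definition graph_class := sgraph -> Prop.

Definition subclass (C D : graph_class) : Prop := forall G, C G -> D G.

(* A finite rooted tree given by its parent map.  Reachability from a
   parentless node excludes cycles, and uniqueness of the parentless node makes
   the forest a tree.  The null tree is allowed: it has no root and no leaf,
   and is what serves as tree-model of the empty graph. *)
Record rtree := RTree {
  node :> finType;
  parent : node -> option node;
  root_unique : forall r s, parent r = None -> parent s = None -> r = s;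
  root_reach : forall x, exists2 r, parent r = None
                 & connect (fun y z => parent z == Some y) r x }.

Definition child (T : rtree) : rel T := fun x y => parent y == Some x.

Definition is_root (T : rtree) (x : T) : bool := parent x == None.

Definition is_leaf (T : rtree) (x : T) : bool := [forall y, ~~ child x y].

Definition descendant (T : rtree) (x y : T) : bool := connect (@child T) x y.

Definition tadj (T : rtree) : rel T := fun x y => child x y || child y x.

Definition tdist (T : rtree) (x y : T) (n : nat) : Prop :=
  (exists p, [/\ path (@tadj T) x p, last x p = y & size p = n]) /\
  (forall p, path (@tadj T) x p -> last x p = y -> n <= size p).

Record tree_model (m d : nat) (G : sgraph) := TreeModel {
  tm_tree : rtree;
  tm_leaf : G -> tm_tree;
  tm_col : G -> 'I_m;
  tm_sig : 'I_m -> 'I_m -> nat -> bool;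
  tm_depth : forall r x : tm_tree, is_root r -> is_leaf x -> tdist r x d;
  tm_leaf_inj : injective tm_leaf;
  tm_leaf_im : forall x : tm_tree, is_leaf x <-> exists v, tm_leaf v = x;
  tm_sig_range : forall i j l, tm_sig i j l -> 1 <= l <= d;
  tm_sig_sym : forall i j l, tm_sig i j l = tm_sig j i l;
  tm_edge : forall (u v : G) (l : nat), u != v ->
    tdist (tm_leaf u) (tm_leaf v) (2 * l) ->
    edge u v = tm_sig (tm_col u) (tm_col v) l }.

Definition TMC (d m k : nat) : graph_class := fun G =>
  exists M : tree_model m d.+1 G, forall r x : tm_tree M,
    is_root r -> tdist r x d ->
    #|[set y : tm_tree M | is_leaf y && descendant x y]| <= k.

Definition copying_sd_le (d : nat) (C : graph_class) : Prop :=
  exists m k, subclass C (TMC d m k).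

Definition copying_sd (d : nat) (C : graph_class) : Prop :=
  copying_sd_le d C /\
  forall d' m k, d = d'.+1 -> ~ subclass C (TMC d' m k).

(* Finite structures over a vocabulary with unary symbols U and binary symbols
   B; no other arity occurs in graphs, their expansions and their copies. *)
Record structure (U B : Type) := Structure {
  dom :> finType;
  un : U -> pred dom;
  bi : B -> rel dom }.

(* Well-scoped de Bruijn syntax: [cmso U B n s] is the type of formulas with n
   free element variables and s free set variables; each quantifier binds
   index 0 and shifts the others. *)
Inductive cmso (U B : Type) : nat -> nat -> Type :=
| FEq n s of 'I_n & 'I_n : cmso U B n s
| FMem n s of 'I_n & 'I_s : cmso U B n s
| FUn n s of U & 'I_n : cmso U B n s
| FBi n s of B & 'I_n & 'I_n : cmso U B n s
| FMod n s (b : nat) (a : 'I_b) of 'I_s : cmso U B n s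
| FNot n s of cmso U B n s : cmso U B n s
| FAnd n s of cmso U B n s & cmso U B n s : cmso U B n s
| FOr n s of cmso U B n s & cmso U B n s : cmso U B n s
| FExElt n s of cmso U B n.+1 s : cmso U B n s
| FAllElt n s of cmso U B n.+1 s : cmso U B n s
| FExSet n s of cmso U B n s.+1 : cmso U B n s
| FAllSet n s of cmso U B n s.+1 : cmso U B n s.

Definition vnil {T : Type} : 'I_0 -> T :=
  fun i => False_rect T (notF (valP i)).

Definition vcons {T : Type} {n : nat} (x : T) (f : 'I_n -> T) : 'I_n.+1 -> T :=
  fun i => oapp f x (unlift ord0 i).

Fixpoint eval (U B : Type) (A : structure U B) (n s : nat) (phi : cmso U B n s)
    : ('I_n -> A) -> ('I_s -> {set A}) -> bool :=
  match phi in cmso _ _ n s return ('I_n -> A) -> ('I_s -> {set A}) -> bool with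
  | FEq _ _ i j => fun e _ => e i == e j
  | FMem _ _ i X => fun e E => e i \in E X
  | FUn _ _ P i => fun e _ => un P (e i)
  | FBi _ _ R i j => fun e _ => bi R (e i) (e j)
  | FMod _ _ b a X => fun _ E => #|E X| %% b == a
  | FNot _ _ f => fun e E => ~~ eval f e E
  | FAnd _ _ f g => fun e E => eval f e E && eval g e E
  | FOr _ _ f g => fun e E => eval f e E || eval g e E
  | FExElt _ _ f => fun e E => [exists x : A, eval f (vcons x e) E]
  | FAllElt _ _ f => fun e E => [forall x : A, eval f (vcons x e) E]
  | FExSet _ _ f => fun e E => [exists X : {set A}, eval f e (vcons X E)]
  | FAllSet _ _ f => fun e E => [forall X : {set A}, eval f e (vcons X E)]
  end.

Definition holds0 (U B : Type) (A : structure U B) (f : cmso U B 0 0) : bool :=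
  @eval U B A 0 0 f vnil vnil.

Definition holds1 (U B : Type) (A : structure U B) (f : cmso U B 1 0) (x : A)
  : bool := @eval U B A 1 0 f (vcons x vnil) vnil.

Definition holds2 (U B : Type) (A : structure U B) (f : cmso U B 2 0) (x y : A)
  : bool := @eval U B A 2 0 f (vcons x (vcons y vnil)) vnil.

Record basic_transduction (U B : Type) := BasicTransduction {
  bt_chi : cmso U B 0 0;
  bt_nu : cmso U B 1 0;
  bt_mu : cmso U B 2 0;
  bt_mu_sym : forall (A : structure U B) (x y : A),
    holds2 bt_mu x y = holds2 bt_mu y x }.

Definition basic_vertex (U B : Type) (t : basic_transduction U B)
  (A : structure U B) : finType := {x : A | holds1 (bt_nu t) x}.

Definition basic_edge (U B : Type) (t : basic_transduction U B)
  (A : structure U B) : rel (basic_vertex t A) :=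
  fun x y => (x != y) && holds2 (bt_mu t) (val x) (val y).

Lemma basic_edge_sym (U B : Type) (t : basic_transduction U B)
  (A : structure U B) : symmetric (@basic_edge U B t A).
Proof. by move=> x y; rewrite /basic_edge eq_sym bt_mu_sym. Qed.

Lemma basic_edge_irrefl (U B : Type) (t : basic_transduction U B)
  (A : structure U B) : irreflexive (@basic_edge U B t A).
Proof. by move=> x; rewrite /basic_edge eqxx. Qed.

(* Meaningful only when A satisfies [bt_chi t]. *)
Definition basic_graph (U B : Type) (t : basic_transduction U B)
  (A : structure U B) : sgraph :=
  SGraph (@basic_edge_sym U B t A) (@basic_edge_irrefl U B t A).

Variant edge_symbol := Edge.

Definition expand (p : nat) (G : sgraph) (Q : 'I_p -> {set G})
  : structure 'I_p edge_symbol :=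
  @Structure 'I_p edge_symbol G
    (fun i v => v \in Q i) (fun _ u v => edge u v).

(* The unary symbol [inr i] is P_i, and the binary symbol [None] is ~. *)
Definition copy (k : nat) (U B : Type) (A : structure U B)
  : structure (U + 'I_k) (option B) :=
  @Structure (U + 'I_k) (option B) (A * 'I_k)%type
    (fun P x => match P with
                | inl P0 => un P0 x.1
                | inr i => x.2 == i
                end)
    (fun R x y => match R with
                  | Some R0 => (x.2 == y.2) && bi R0 x.1 y.1
                  | None => x.1 == y.1
                  end).

Record transduction := Transduction {
  td_p : nat;
  td_k : nat;
  td_basic : basic_transduction ('I_td_p + 'I_td_k) (option edge_symbol) }.

(* H belongs to tau(G); graphs are taken up to isomorphism. *)
Definition transduces (tau : transduction) (G H : sgraph) : Prop :=
  exists Q : 'I_(td_p tau) -> {set G},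
    let A := copy (td_k tau) (expand Q) in
    holds0 A (bt_chi (td_basic tau)) /\
    graph_iso H (basic_graph (td_basic tau) A).

Definition image_class (tau : transduction) (C : graph_class) : graph_class :=
  fun H => exists2 G, C G & transduces tau G H.

(* Main.v *)
Require Import Defs.
From HB Require Import structures.
From mathcomp Require Import all_boot perm zify.

(** A copied tree-model of depth [d] is the same thing as an integer ultrametric
on the vertices, bounded by [d.+1] and with bounded balls of radius 1, together
with a bounded colouring such that adjacency of two vertices depends only on
their colours and on their distance.  Copying the vertices keeps this form: the
copies of a vertex are put at distance 1, and a colour records the copy, the
unary predicates, and a number that tells apart the vertices of a ball of
radius 1.

The type of a coloured ball of radius [h.+1] records the types of its sub-balls
of radius [h] with their multiplicities, exactly below a threshold and modulo a
fixed number above it, so that there are boundedly many types.  Elements and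
sets assigned to variables are just additional colours, and a back-and-forth
argument, paying with larger thresholds, shows that types determine the truth of
CMSO formulas.  Finally, the type of the structure with both [x] and [y] marked
is determined by the distance of [x] and [y] and by the types of the structure
with only [x] and only [y] marked: these types are the new colours, and the
distance, hence the depth, does not change. *)

Set Implicit Arguments.
Unset Strict Implicit.
Unset Printing Implicit Defensive.

(** * Truncated counting *)

Lemma eq_modn_sum d (I : finType) (P : pred I) (F G : I -> nat) :
  (forall i, P i -> F i = G i %[mod d]) ->
  \sum_(i | P i) F i = \sum_(i | P i) G i %[mod d].
Proof.
move=> eqFG; rewrite -modn_summ -[RHS]modn_summ.
by congr (_ %% _); apply: eq_bigr.
Qed.

Section TruncatedCount.

Variable M : nat.

(* Exact below the threshold [t]; above it, only the residue modulo [M.+1]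
   is kept.  The successor makes the modulus positive. *)
Definition tcount t n : 'I_(t + M).+1 :=
  inord (if n < t then n else t + (n - t) %% M.+1).

Lemma val_tcount t n :
  tcount t n = (if n < t then n else t + (n - t) %% M.+1) :> nat.
Proof.
rewrite /= inordK //; case: (ltnP n t) => [lt_nt|_]; first by lia.
by have := ltn_pmod (n - t) (ltn0Sn M); lia.
Qed.

Lemma tcount_mod t n : tcount t n = n %[mod M.+1].
Proof.
by rewrite val_tcount; case: ltnP => // le_tn; rewrite modnDmr subnKC.
Qed.

Lemma leq_tcount t n : t <= n -> t <= tcount t n.
Proof. by move=> le_tn; rewrite val_tcount ltnNge le_tn leq_addr. Qed.

Lemma tcount_id t n : n < t -> tcount t n = n :> nat.
Proof. by move=> lt_nt; rewrite val_tcount lt_nt. Qed.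

Lemma tcountP t a b :
  tcount t a = tcount t b <->
  a = b \/ [/\ t <= a, t <= b & a = b %[mod M.+1]].
Proof.
split=> [eq_ab|[->|[le_ta le_tb eq_mod]]] //; last first.
  apply/val_inj; rewrite /= !val_tcount !ltnNge le_ta le_tb /=; congr (t + _).
  by apply/eqP; rewrite -(eqn_modDl t) !subnKC // eq_mod.
have eq_mod : a = b %[mod M.+1].
  by rewrite -(tcount_mod t a) eq_ab tcount_mod.
have {}eq_ab : tcount t a = tcount t b :> nat by rewrite eq_ab.
have [lt_at|le_ta] := ltnP a t; have [lt_bt|le_tb] := ltnP b t.
- by left; rewrite -(tcount_id lt_at) eq_ab tcount_id.
- by have := leq_tcount le_tb; rewrite -eq_ab tcount_id // leqNgt lt_at.
- by have := leq_tcount le_ta; rewrite eq_ab tcount_id // leqNgt lt_bt.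
- by right.
Qed.

Lemma tcountK t n : tcount t (tcount t n) = tcount t n.
Proof.
apply/tcountP; have [lt_nt|le_tn] := ltnP n t; first by left; rewrite tcount_id.
by right; rewrite leq_tcount ?tcount_mod.
Qed.

Lemma tcountD t a a' b b' : tcount t a = tcount t a' ->
  tcount t b = tcount t b' -> tcount t (a + b) = tcount t (a' + b').
Proof.
move=> /tcountP eq_a /tcountP eq_b; apply/tcountP.
have eq_mod : a + b = a' + b' %[mod M.+1].
  have eq_modM : a = a' %[mod M.+1] by case: eq_a => [->|[]].
  rewrite -modnDml eq_modM modnDml -modnDmr.
  by rewrite (_ : b %% _ = b' %% M.+1) ?modnDmr //; case: eq_b => [->|[]].
case: eq_a eq_b eq_mod => [->|[? ? _]] [->|[? ? _]] ?;
  by [left | right; split=> //; lia].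
Qed.

Lemma tcount_sum t (I : finType) (P : pred I) (F G : I -> nat) :
  (forall i, P i -> tcount t (F i) = tcount t (G i)) ->
  tcount t (\sum_(i | P i) F i) = tcount t (\sum_(i | P i) G i).
Proof.
move=> eqFG; apply: (big_ind2 (fun a b => tcount t a = tcount t b)) => //.
by move=> a a' b b'; apply: tcountD.
Qed.

Lemma tcount_geq t j a b :
  tcount t a = tcount t b -> j <= t -> j <= a -> j <= b.
Proof. by move/tcountP => [->|[]] //; lia. Qed.

Lemma tcount_sum_split (S : finType) t T (n : S -> nat) b :
    #|S| * (t + M.+1) < T -> tcount T (\sum_s n s) = tcount T b ->
  exists2 n' : S -> nat,
    \sum_s n' s = b & forall s, tcount t (n s) = tcount t (n' s).
Proof.
move=> ltT /tcountP[<-|[leTa leTb eq_mod]]; first by exists n.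
have sum_const j : \sum_(s : S) j = #|S| * j by rewrite sum_nat_const.
have [s0 le_s0|all_lt] := pickP (fun s => t <= n s); last first.
  have: \sum_s n s <= \sum_(s : S) t.
    by apply: leq_sum => s _; rewrite ltnW // ltnNge all_lt.
  by rewrite sum_const; nia.
set m := \sum_s (tcount t (n s) : nat).
have le_mb : m <= b.
  apply: leq_trans (leq_trans (ltnW ltT) leTb); rewrite -sum_const addnS.
  by apply: leq_sum => s _; apply: ltnW.
have dvd_bm : M.+1 %| b - m.
  rewrite -eqn_mod_dvd // -eq_mod; apply/eqP/eq_modn_sum => s _.
  by rewrite tcount_mod.
(* The excess, a multiple of the modulus, goes to a class that is already
   above the threshold. *)
exists (fun s => tcount t (n s) + (s == s0) * (b - m)).
  rewrite big_split /= -/m (bigD1 s0) //= eqxx mul1n big1 ?addn0 ?subnKC //.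
  by move=> s /negbTE->.
move=> s; have [->|_] := eqVneq s s0; last by rewrite addn0 tcountK.
apply/tcountP; right; split=> //.
  by rewrite (leq_trans (leq_tcount le_s0)) ?leq_addr.
by rewrite mul1n -modnDmr (eqP dvd_bm) addn0 tcount_mod.
Qed.

End TruncatedCount.

Definition fibre (X : finType) (S : eqType) (Z : {set X}) (g : X -> S) s :=
  [set z in Z | g z == s].

Lemma card_fibres (X S : finType) (Z : {set X}) (g : X -> S) (P : pred S) :
  #|[set z in Z | P (g z)]| = \sum_(s | P s) #|fibre Z g s|.
Proof.
rewrite -sum1_card (partition_big g P) /=; last by move=> z /[!inE] /andP[].
apply: eq_bigr => s Ps; rewrite -sum1_card; apply: eq_bigl => z.
by rewrite !inE; case: eqP => [->|]; rewrite ?Ps ?andbT ?andbF.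
Qed.

Lemma sum_card_fibres (X S : finType) (Z : {set X}) (g : X -> S) :
  \sum_s #|fibre Z g s| = #|Z|.
Proof.
by rewrite -(card_fibres Z g xpredT); apply: eq_card => z; rewrite inE andbT.
Qed.

Lemma card_fibre_split (X S L : finType) (Z : {set X}) (p : X -> L)
    (g : X -> S) s :
  #|fibre Z g s| = \sum_l #|fibre (fibre Z p l) g s|.
Proof.
rewrite -(sum_card_fibres (fibre Z g s) p); apply: eq_bigr => l _.
by apply: eq_card => z; rewrite !inE andbAC.
Qed.

Lemma exists_fibres (X S : finType) (Z : {set X}) (n : S -> nat) (s0 : S) :
  \sum_s n s = #|Z| -> exists g : X -> S, forall s, #|fibre Z g s| = n s.
Proof.
move=> sum_n; pose l := flatten [seq nseq (n s) s | s <- enum S].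
have size_l : size l = size (enum Z).
  rewrite -cardE -sum_n size_flatten /shape -map_comp sumnE big_map big_enum /=.
  by apply: eq_bigr => s _; rewrite size_nseq.
have count_l s : count_mem s l = n s.
  rewrite count_flatten -map_comp sumnE big_map big_enum /= (bigD1 s) //= big1.
    by rewrite count_nseq /= eqxx mul1n addn0.
  by move=> s' neq_s; rewrite count_nseq /= (negbTE neq_s).
pose g z := nth s0 l (index z (enum Z)); exists g => s.
have map_g : map g (enum Z) = l.
  apply: (@eq_from_nth _ s0); rewrite size_map // => i lt_i.
  have /card_gt0P[x0 _] : 0 < #|Z| by rewrite cardE (leq_trans _ lt_i).
  by rewrite (nth_map x0) // /g index_uniq ?enum_uniq.
rewrite -count_l -map_g count_map -size_filter cardE /enum_mem -filter_predI.
by congr size; apply: eq_filter => z; rewrite !inE andbC.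
Qed.

Lemma transfer_labelling M t T (X X' L S : finType) (Z : {set X})
    (Z' : {set X'}) (p : X -> L) (p' : X' -> L) (g : X -> S) (s0 : S) :
    0 < t -> #|S| * (t + M.+1) < T ->
    (forall l, tcount M T #|fibre Z p l| = tcount M T #|fibre Z' p' l|) ->
  exists2 g' : X' -> S,
    forall z', z' \in Z' -> exists z, [/\ z \in Z, p z = p' z' & g z = g' z']
  & forall s, tcount M t #|fibre Z g s| = tcount M t #|fibre Z' g' s|.
Proof.
move=> t_gt0 ltT eq_pp'.
have /fin_all_exists[g' g'P] l : exists gl : X' -> S, forall s,
    tcount M t #|fibre (fibre Z p l) g s|
  = tcount M t #|fibre (fibre Z' p' l) gl s|.
  have := eq_pp' l; rewrite -(sum_card_fibres _ g).
  case/(tcount_sum_split ltT) => n' sum_n' eq_n'.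
  by have [gl glE] := exists_fibres s0 sum_n'; exists gl => s; rewrite glE.
exists (fun z => g' (p' z) z) => [z' Zz'|s].
  have: 0 < #|fibre (fibre Z p (p' z')) g (g' (p' z') z')|.
    apply: (tcount_geq (esym (g'P _ _)) t_gt0).
    by apply/card_gt0P; exists z'; rewrite !inE Zz' !eqxx.
  case/card_gt0P => z; rewrite !inE => /andP[/andP[Zz /eqP eq_p] /eqP eq_g].
  by exists z.
rewrite (card_fibre_split Z p) (card_fibre_split Z' p').
apply: tcount_sum => l _; rewrite g'P; congr (tcount _ _ _).
by apply: eq_card => z; rewrite !inE; case: eqP => [->|]; rewrite ?andbF.
Qed.

(** * Integer ultrametrics *)

Record ultrametric (X : finType) := Ultrametric {
  udist :> X -> X -> nat;
  udist_eq0 : forall x y, (udist x y == 0) = (x == y);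
  udistC : forall x y, udist x y = udist y x;
  udist_ultra : forall y x z, udist x z <= maxn (udist x y) (udist y z) }.

Section Ultrametric.

Variables (X : finType) (rho : ultrametric X).

Lemma udistxx x : rho x x = 0.
Proof. by apply/eqP; rewrite udist_eq0. Qed.

Lemma udist_trans h y x z : rho x y <= h -> rho y z <= h -> rho x z <= h.
Proof.
move=> le_xy le_yz; apply: leq_trans (udist_ultra rho y x z) _.
by rewrite geq_max le_xy.
Qed.

Lemma udist_leq_congr h x y z : rho x y <= h -> (rho x z <= h) = (rho y z <= h).
Proof.
move=> le_xy; apply/idP/idP; apply: udist_trans => //.
by rewrite udistC.
Qed.

Definition ball h x := [set y | rho x y <= h].

Definition center h x := odflt x [pick y in ball h x].

Lemma center_in h x : rho x (center h x) <= h.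
Proof.
by rewrite /center; case: pickP => [y|_]; rewrite ?inE //= udistxx.
Qed.

Lemma center_eq h x y : (center h x == center h y) = (rho x y <= h).
Proof.
apply/eqP/idP => [eq_xy|le_xy].
  apply: udist_trans (center_in h x) _.
  by rewrite eq_xy udistC center_in.
have eq_ball: ball h x =i ball h y.
  by move=> z; rewrite !inE (udist_leq_congr _ le_xy).
rewrite /center (eq_pick eq_ball).
by case: pickP => // /(_ y); rewrite inE udistxx.
Qed.

Lemma center_id h x : center h (center h x) = center h x.
Proof. by apply/eqP; rewrite center_eq udistC center_in. Qed.

Definition subballs h x := [set z | (center h z == z) && (rho z x <= h.+1)].

Lemma center_subball h x y : rho x y <= h.+1 -> center h y \in subballs h x.
Proof.
move=> le_xy; rewrite inE center_id eqxx /= udistC.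
exact: udist_trans le_xy (leqW (center_in h y)).
Qed.

Lemma subballP h x z :
  reflect (center h z = z /\ rho z x <= h.+1) (z \in subballs h x).
Proof. by rewrite inE; apply: (iffP andP) => -[/eqP]. Qed.

Lemma subball_center h x y z :
  z \in subballs h x -> (center h y == z) = (rho y z <= h).
Proof. by move=> /subballP[cz _]; rewrite -{1}cz center_eq. Qed.

Lemma eq_subballs h x y : rho x y <= h.+1 -> subballs h x = subballs h y.
Proof.
move=> le_xy; apply/setP => z.
by rewrite !inE ![rho z _]udistC (udist_leq_congr _ le_xy).
Qed.

Lemma udist_distinct_subballs h x z1 z2 y1 y2 :
  z1 \in subballs h x -> z2 \in subballs h x -> z1 != z2 ->
  rho z1 y1 <= h -> rho z2 y2 <= h -> rho y1 y2 = h.+1.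
Proof.
move=> /subballP[center_z1 le_z1x] /subballP[center_z2 le_z2x] neq_z.
move=> le_zy1 le_zy2; rewrite [rho z2 x]udistC in le_z2x.
have : ~~ (rho y1 y2 <= h).
  rewrite -(udist_leq_congr _ le_zy1) udistC -(udist_leq_congr _ le_zy2) udistC.
  by rewrite -center_eq center_z1 center_z2.
rewrite -ltnNge => lt_y; apply/eqP; rewrite eqn_leq lt_y andbT.
rewrite -(udist_leq_congr _ (leqW le_zy1)) udistC.
rewrite -(udist_leq_congr _ (leqW le_zy2)) udistC.
exact: udist_trans le_z1x le_z2x.
Qed.

Lemma card_ball_succ h x (P : pred X) :
  #|[set y in ball h.+1 x | P y]|
  = \sum_(z in subballs h x) #|[set y in ball h z | P y]|.
Proof.
rewrite -sum1_card (partition_big (center h) [in subballs h x]) /=; last first.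
  by move=> y; rewrite !inE => /andP[/center_subball]; rewrite inE.
apply: eq_bigr => z z_sub; rewrite -sum1_card; apply: eq_bigl => y.
rewrite !inE (subball_center _ z_sub) [rho y z]udistC andbC.
case: leqP => //= le_zy; have /subballP[_] := z_sub.
by rewrite udistC => /udist_trans/(_ (leqW le_zy))->.
Qed.

End Ultrametric.

(** * Types of coloured balls *)

Fixpoint ball_type (M t : nat) (C : finType) (h : nat) : finType :=
  if h is h'.+1 then {ffun ball_type M t C h' -> 'I_(t + M).+1} else C.

Definition mult M t C h (F : ball_type M t C h.+1) (u : ball_type M t C h) :
  'I_(t + M).+1 := (F : {ffun ball_type M t C h -> 'I_(t + M).+1}) u.

Lemma mult_inj M t C h (F G : ball_type M t C h.+1) :
  mult F =1 mult G -> F = G.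
Proof. by move=> eqFG; apply/ffunP. Qed.

Fixpoint map_type M t (C C' : finType) (phi : C -> C') h :
    ball_type M t C h -> ball_type M t C' h :=
  if h is h'.+1 return ball_type M t C h -> ball_type M t C' h then
    fun F => [ffun v => tcount M t (\sum_(u | map_type phi u == v) mult F u)]
  else phi.

Fixpoint type_card M t (C : finType) (P : pred C) h :
    ball_type M t C h -> nat :=
  if h is h'.+1 return ball_type M t C h -> nat then
    fun F => \sum_u mult F u * type_card P u
  else P.

Section Types.

Variables (X : finType) (rho : ultrametric X) (M : nat).

Fixpoint tp t (C : finType) (c : X -> C) h x : ball_type M t C h :=
  if h is h'.+1 return ball_type M t C h then
    [ffun u => tcount M t #|fibre (subballs rho h' x) (tp t c h') u|]
  else c x.

Section FixedThreshold.

Variable t : nat.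

Lemma mult_tp (C : finType) (c : X -> C) h x (u : ball_type M t C h) :
  mult (tp t c h.+1 x) u = tcount M t #|fibre (subballs rho h x) (tp t c h) u|.
Proof. by rewrite /mult ffunE. Qed.

Lemma tp_succP (C : finType) (c c' : X -> C) h x x' :
  tp t c h.+1 x = tp t c' h.+1 x' <->
  forall u, tcount M t #|fibre (subballs rho h x) (tp t c h) u|
          = tcount M t #|fibre (subballs rho h x') (tp t c' h) u|.
Proof.
split=> [eq_tp u|eq_count]; first by rewrite -!mult_tp eq_tp.
by apply: mult_inj => u; rewrite !mult_tp.
Qed.

Lemma tp_same_ball (C : finType) (c : X -> C) h x y :
  rho x y <= h -> tp t c h x = tp t c h y.
Proof.
case: h => [|h] le_xy /=; last by rewrite (eq_subballs le_xy).
by congr c; apply/eqP; rewrite -(udist_eq0 rho) -leqn0.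
Qed.

Lemma tp_center (C : finType) (c : X -> C) h x :
  tp t c h (center rho h x) = tp t c h x.
Proof. by apply: tp_same_ball; rewrite udistC center_in. Qed.

Lemma eq_tp (C : finType) (c c' : X -> C) h x :
  (forall y, rho x y <= h -> c y = c' y) -> tp t c h x = tp t c' h x.
Proof.
elim: h x => [|h IH] x eq_c; first by apply: eq_c; rewrite udistxx.
apply/tp_succP => u; congr (tcount _ _ _); apply: eq_card => z.
rewrite inE [RHS]inE; case: subballP => //= -[_]; rewrite udistC => le_xz.
rewrite (IH z) // => y le_zy.
by apply: eq_c; apply: udist_trans le_xz (leqW le_zy).
Qed.

Lemma tp_comp (C C' : finType) (phi : C -> C') (c : X -> C) h x :
  tp t (phi \o c) h x = map_type phi (tp t c h x).
Proof.
elim: h x => [|h IH] x //; apply: mult_inj => v; rewrite mult_tp /mult ffunE.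
transitivity (tcount M t
    #|[set z in subballs rho h x | map_type phi (tp t c h z) == v]|).
  by congr (tcount _ _ _); apply: eq_card => z; rewrite !inE IH.
rewrite (card_fibres _ (tp t c h) (fun u => map_type phi u == v)).
by apply: tcount_sum => // u _; rewrite mult_tp tcountK.
Qed.

Lemma tp_recolour (C C' : finType) (phi : C -> C') (c c' : X -> C) d d' h x x' :
  d =1 phi \o c -> d' =1 phi \o c' ->
  tp t c h x = tp t c' h x' -> tp t d h x = tp t d' h x'.
Proof.
move=> dE dE' eq_c.
rewrite (@eq_tp _ d (phi \o c)) // (@eq_tp _ d' (phi \o c')) //.
by rewrite (tp_comp phi c) (tp_comp phi c') eq_c.
Qed.

Lemma card_tp (C : finType) (P : pred C) (c : X -> C) h x :
  #|[set y in ball rho h x | P (c y)]| = type_card P (tp t c h x) %[mod M.+1].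
Proof.
elim: h x => [|h IH] x.
  have -> : [set y in ball rho 0 x | P (c y)]
          = if P (c x) then [set x] else set0.
    apply/setP => y; rewrite !inE leqn0 udist_eq0 eq_sym.
    by case: ifP; rewrite inE; case: eqP => [->|].
  by rewrite /=; case: (P (c x)); rewrite ?cards1 ?cards0.
rewrite card_ball_succ.
rewrite (eq_modn_sum (G := fun z => type_card P (tp t c h z))) => [|z _ //].
rewrite (partition_big (tp t c h) xpredT) //=; apply: eq_modn_sum => u _.
rewrite mult_tp -[RHS]modnMml tcount_mod modnMml -sum_nat_const.
congr (_ %% _); apply: eq_big => [z|z /andP[_ /eqP->] //].
by rewrite [RHS]inE.
Qed.

Lemma tp_subball (C : finType) (c c' : X -> C) h x x' z : 0 < t ->
  tp t c h.+1 x = tp t c' h.+1 x' -> z \in subballs rho h x ->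
  exists2 z', z' \in subballs rho h x' & tp t c h z = tp t c' h z'.
Proof.
move=> t_gt0 /tp_succP/(_ (tp t c h z)) eq_count z_sub.
have /card_gt0P[z'] : 0 < #|fibre (subballs rho h x') (tp t c' h) (tp t c h z)|.
  apply: (tcount_geq eq_count t_gt0); apply/card_gt0P; exists z.
  by rewrite inE z_sub eqxx.
by rewrite inE => /andP[z'_sub /eqP]; exists z'.
Qed.

Lemma tp_elt (C : finType) (c c' : X -> C) h x x' y : 0 < t ->
  tp t c h x = tp t c' h x' -> rho x y <= h ->
  exists2 y', rho x' y' <= h & c y = c' y'.
Proof.
move=> t_gt0; elim: h x x' => [|h IH] x x' eq_tp_x.
  rewrite leqn0 udist_eq0 => /eqP<-; exists x' => //.
  by rewrite udistxx.
move=> /center_subball/(tp_subball t_gt0 eq_tp_x)[z' /subballP[_ le_zx]].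
rewrite tp_center => /IH[|y' le_zy ->]; first by rewrite udistxx.
exists y' => //; rewrite udistC in le_zx.
exact: udist_trans le_zx (leqW le_zy).
Qed.

Lemma tp_two_subballs (C : finType) (c c' : X -> C) h x x' z1 z2 : 1 < t ->
  tp t c h.+1 x = tp t c' h.+1 x' ->
  z1 \in subballs rho h x -> z2 \in subballs rho h x -> z1 != z2 ->
  exists z1' z2', [/\ z1' \in subballs rho h x', z2' \in subballs rho h x',
    z1' != z2', tp t c h z1 = tp t c' h z1' & tp t c h z2 = tp t c' h z2'].
Proof.
move=> t_gt1 eq_tp_x z1_sub z2_sub neq_z; have t_gt0 := ltnW t_gt1.
have [eq_tp_z|neq_tp_z] := eqVneq (tp t c h z1) (tp t c h z2); last first.
  have [z1' z1'_sub eq1] := tp_subball t_gt0 eq_tp_x z1_sub.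
  have [z2' z2'_sub eq2] := tp_subball t_gt0 eq_tp_x z2_sub.
  exists z1', z2'; split=> //; apply: contraNneq neq_tp_z => eq_z'.
  by rewrite eq1 eq2 eq_z'.
have /card_gt1P[z1' [z2' [z1'_in z2'_in neq_z']]] :
    1 < #|fibre (subballs rho h x') (tp t c' h) (tp t c h z1)|.
  move/tp_succP/(_ (tp t c h z1)): eq_tp_x => eq_count.
  apply: (tcount_geq eq_count t_gt1); apply/card_gt1P.
  by exists z1, z2; split; rewrite // inE ?z1_sub ?z2_sub -?eq_tp_z eqxx.
move: z1'_in z2'_in; rewrite !inE.
move=> /andP[z1'_sub /eqP eq1] /andP[z2'_sub /eqP eq2].
by exists z1', z2'; split; rewrite -?eq_tp_z ?inE.
Qed.

Lemma tp_pair (C : finType) (c c' : X -> C) h x x' y1 y2 : 1 < t ->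
  tp t c h x = tp t c' h x' -> rho x y1 <= h -> rho x y2 <= h ->
  exists y1' y2', [/\ c y1 = c' y1', c y2 = c' y2' & rho y1 y2 = rho y1' y2'].
Proof.
move=> t_gt1; have t_gt0 := ltnW t_gt1.
elim: h x x' => [|h IH] x x' eq_tp_x.
  rewrite !leqn0 !udist_eq0 => /eqP<- /eqP<-.
  by exists x', x'; split; rewrite ?udistxx.
move=> /center_subball z1_sub /center_subball z2_sub.
set z1 := center _ _ _ in z1_sub; set z2 := center _ _ _ in z2_sub.
have le_1 : rho z1 y1 <= h by rewrite udistC center_in.
have le_2 : rho z2 y2 <= h by rewrite udistC center_in.
have [eq_z|neq_z] := eqVneq z1 z2.
  have [z' _ /IH] := tp_subball t_gt0 eq_tp_x z1_sub.
  by apply; rewrite // eq_z.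
have [z1' [z2' [z1'_sub z2'_sub neq_z' eq1 eq2]]] :=
  tp_two_subballs t_gt1 eq_tp_x z1_sub z2_sub neq_z.
have [y1' le_1' ?] := tp_elt t_gt0 eq1 le_1.
have [y2' le_2' ?] := tp_elt t_gt0 eq2 le_2.
exists y1', y2'; split=> //.
rewrite (udist_distinct_subballs z1_sub z2_sub) //.
by rewrite (udist_distinct_subballs z1'_sub z2'_sub).
Qed.

Definition mark (C : Type) (c : X -> C) a y := (c y, a == y).

Lemma tp_mark_pred (C : finType) (c : X -> C) h a b : 0 < t ->
  tp t (mark c a) h.+1 a = tp t (mark c b) h.+1 b ->
  tp t (mark c a) h a = tp t (mark c b) h b.
Proof.
move=> t_gt0 eq_tp_h; have a_sub : center rho h a \in subballs rho h a.
  by apply: center_subball; rewrite udistxx.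
have [z' _] := tp_subball t_gt0 eq_tp_h a_sub; rewrite tp_center => eq_tp_z'.
have [|y' le_zy []] := tp_elt t_gt0 eq_tp_z' (y := a); first by rewrite udistxx.
rewrite eqxx => _ /esym/eqP eq_by.
by rewrite eq_tp_z' (tp_same_ball _ le_zy) eq_by.
Qed.

Lemma tp_mark_leq (C : finType) (c : X -> C) l h a b : 0 < t -> l <= h ->
  tp t (mark c a) h a = tp t (mark c b) h b ->
  tp t (mark c a) l a = tp t (mark c b) l b.
Proof.
move=> t_gt0 /subnKC<-; elim: (h - l) => [|j IH]; first by rewrite addn0.
by rewrite addnS => /(tp_mark_pred t_gt0)/IH.
Qed.

Lemma tp_mark_unmark (C : finType) (c : X -> C) h a b :
  tp t (mark c a) h a = tp t (mark c b) h b -> tp t c h a = tp t c h b.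
Proof. exact: (tp_recolour (phi := fst)). Qed.

Lemma tp_mark_off (C : finType) (c : X -> C) h a x : h < rho a x ->
  tp t (mark c a) h x = tp t (fun y => (c y, false)) h x.
Proof.
move=> lt_ax; apply: eq_tp => y le_xy; congr (_, _); apply/eqP => eq_ay.
by move: lt_ax; rewrite eq_ay udistC ltnNge le_xy.
Qed.

(* Transposing the sub-balls of [a] and of [b] transforms the ball with [a]
   marked into the ball with [b] marked. *)
Lemma tp_mark_swap (C : finType) (c : X -> C) h a b : rho a b <= h.+1 ->
  tp t (mark c a) h a = tp t (mark c b) h b ->
  tp t (mark c a) h.+1 a = tp t (mark c b) h.+1 b.
Proof.
move=> le_ab eq_tp_h; rewrite (tp_same_ball _ le_ab); apply/tp_succP => u.
pose swap := tperm (center rho h a) (center rho h b).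
have a_sub : center rho h a \in subballs rho h b.
  by apply: center_subball; rewrite udistC.
have b_sub : center rho h b \in subballs rho h b.
  by apply: center_subball; rewrite udistxx.
have swap_sub z : (swap z \in subballs rho h b) = (z \in subballs rho h b).
  by rewrite /swap; case: tpermP => [->|->|]; rewrite ?a_sub ?b_sub.
have eq_unmarked := tp_mark_unmark eq_tp_h.
have swap_tp z : z \in subballs rho h b ->
    tp t (mark c b) h (swap z) = tp t (mark c a) h z.
  have off d z' : center rho h z' = z' -> z' != center rho h d ->
      tp t (mark c d) h z' = tp t (fun y => (c y, false)) h z'.
    move=> cz' neq_z'; apply: tp_mark_off.
    by rewrite ltnNge -center_eq cz' eq_sym.
  move=> /subballP[cz _]; rewrite /swap; case: tpermP => [->|->|/eqP ? /eqP ?].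
  - by rewrite !tp_center.
  - have [eq_ab|neq_ab] := eqVneq (center rho h a) (center rho h b).
      by rewrite eq_ab tp_center -eq_ab tp_center.
    rewrite !off ?center_id //; last by rewrite eq_sym.
    rewrite !tp_center.
    exact: (tp_recolour (phi := fun k => (k, false)) _ _ eq_unmarked).
  - by rewrite !off.
congr (tcount _ _ _); rewrite -[RHS](card_preimset _ (@perm_inj _ swap)).
apply: eq_card => z; rewrite inE [RHS]inE [in RHS]inE swap_sub.
by case: (boolP (z \in _)) => //= z_sub; rewrite swap_tp.
Qed.

Lemma tp_mark_swap_leq (C : finType) (c : X -> C) l h a b :
  l < h -> rho a b <= l.+1 ->
  tp t (mark c a) l a = tp t (mark c b) l b ->
  tp t (mark c a) h a = tp t (mark c b) h b.
Proof.
move=> /subnKC<- le_ab eq_tp_l; elim: (h - l.+1) => [|j IH].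
  by rewrite addn0; apply: tp_mark_swap.
rewrite addnS; apply: tp_mark_swap IH.
by apply: leq_trans le_ab _; rewrite -addnS leq_addr.
Qed.

(* If [a] is at distance [l.+1] from [y], then the ball of radius [l] around [a]
   misses [y], so that swapping two such balls leaves the mark on [y] alone. *)
Lemma tp_mark2_swap (C : finType) (c : X -> C) h y a b : 0 < t ->
  rho a y <= h -> rho a y = rho b y ->
  tp t (mark c a) h a = tp t (mark c b) h b ->
  tp t (mark (mark c y) a) h a = tp t (mark (mark c y) b) h b.
Proof.
move=> t_gt0 le_ay eq_y eq_tp_h; case dist_ay: (rho a y) eq_y le_ay => [|l].
  move=> /esym/eqP; rewrite udist_eq0 => /eqP-> _.
  by move/eqP: dist_ay; rewrite udist_eq0 => /eqP->.
move=> /esym dist_by lt_lh.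
have le_ab : rho a b <= l.+1.
  by apply: (@udist_trans _ _ _ y); rewrite ?dist_ay // udistC dist_by.
apply: (tp_mark_swap_leq lt_lh le_ab).
have off d : rho d y = l.+1 ->
    tp t (mark (mark c y) d) l d = tp t (fun z => ((c z, false), d == z)) l d.
  move=> dist_dy; apply: eq_tp => z le_dz; congr (_, _, _); apply/eqP => eq_yz.
  by move: le_dz; rewrite -eq_yz dist_dy ltnn.
rewrite !off //.
have := tp_mark_leq t_gt0 (ltnW lt_lh) eq_tp_h.
exact: (tp_recolour (phi := fun k => ((k.1, false), k.2))).
Qed.

End FixedThreshold.

(* Any number above 1 and above each of the summands would do. *)
Definition refine_threshold t (C : finType) h :=
  (\sum_(l < h) #|ball_type M t C l| * (t + M.+1)).+2.

Lemma refine_threshold_gt t (C : finType) h l : l < h ->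
  #|ball_type M t C l| * (t + M.+1) < refine_threshold t C h.
Proof.
by move=> lt_lh; rewrite ltnS (bigD1 (Ordinal lt_lh)) //= leqW // leq_addr.
Qed.

Lemma tp_refine t T (C C2 : finType) h (c c' : X -> C) x x' (f : X -> C2) :
  0 < t -> refine_threshold t (C * C2)%type h <= T ->
  tp T c h x = tp T c' h x' ->
  exists f' : X -> C2,
    tp t (fun y => (c y, f y)) h x = tp t (fun y => (c' y, f' y)) h x'.
Proof.
move=> t_gt0 leT.
have {leT} ltT l : l < h -> #|ball_type M t (C * C2)%type l| * (t + M.+1) < T.
  by move=> /refine_threshold_gt lt_l; apply: leq_trans (lt_l _ _) leT.
elim: h ltT x x' => [|h IH] ltT x x'.
  by move=> /= eq_c; exists (fun=> f x); rewrite eq_c.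
move=> /tp_succP eq_count; pose cf y := (c y, f y).
have [g' g'P g'_count] := transfer_labelling (tp t cf h) (tp t cf h x) t_gt0
  (ltT h (ltnSn h)) eq_count.
have /fin_all_exists[F FE] z' : exists fz : X -> C2, z' \in subballs rho h x' ->
    g' z' = tp t (fun y => (c' y, fz y)) h z'.
  have [/g'P[z [_ eq_tp_z <-]]|_] := boolP (z' \in subballs rho h x').
    have [|fz ->] := IH _ _ _ eq_tp_z; last by exists fz.
    by move=> l /ltnW; apply: ltT.
  by exists f.
exists (fun y => F (center rho h y) y); apply/tp_succP => u.
rewrite [LHS]g'_count; congr (tcount _ _ _).
apply: eq_card => z'; rewrite inE [in RHS]inE.
have [z'_sub|//] := boolP (z' \in subballs rho h x').
rewrite FE // (@eq_tp _ _ _ (fun y => (c' y, F (center rho h y) y))) // => y.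
by rewrite udistC -(subball_center _ z'_sub) => /eqP->.
Qed.

Lemma tp_coarsen t T (C : finType) h (c c' : X -> C) x x' : 0 < t ->
  refine_threshold t (C * bool)%type h <= T ->
  tp T c h x = tp T c' h x' -> tp t c h x = tp t c' h x'.
Proof.
move=> t_gt0 leT /(tp_refine (fun=> true) t_gt0 leT)[f'].
exact: (tp_recolour (phi := fst)).
Qed.

Lemma tp_mark_forth t T (C : finType) h (c c' : X -> C) x x' a : 1 < t ->
  refine_threshold t (C * bool)%type h <= T ->
  tp T c h x = tp T c' h x' -> rho x a <= h ->
  exists2 a', rho x' a' <= h & tp t (mark c a) h x = tp t (mark c' a') h x'.
Proof.
move=> t_gt1 leT eq_tp_x le_xa; have t_gt0 := ltnW t_gt1.
have [f' eq_f'] := tp_refine (fun y => a == y) t_gt0 leT eq_tp_x.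
have [a' le_xa' []] := tp_elt t_gt0 eq_f' le_xa.
rewrite eqxx => _ /esym f'a'; exists a' => //.
rewrite eq_f'; apply: eq_tp => y le_xy; congr (_, _).
apply/idP/eqP => [f'y|<-//].
have [a1 [a2 [[_ f'_a1] [_ f'_a2] eq_dist]]] :=
  tp_pair t_gt1 (esym eq_f') le_xa' le_xy.
have eq_a1 : a = a1 by apply/eqP; rewrite -f'_a1 f'a'.
have eq_a2 : a = a2 by apply/eqP; rewrite -f'_a2 f'y.
by apply/eqP; rewrite -(udist_eq0 rho) eq_dist -eq_a1 -eq_a2 udistxx.
Qed.

Lemma udist_mark2 t (C : finType) h (c c' : X -> C) z z' x y x' y' : 1 < t ->
  tp t (mark (mark c y) x) h z = tp t (mark (mark c' y') x') h z' ->
  rho z x <= h -> rho z y <= h -> rho x y = rho x' y'.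
Proof.
move=> t_gt1 eq_tp_z le_zx le_zy.
have [x1 [y1 [[_ _ eq_x] [_ eq_y _] ->]]] := tp_pair t_gt1 eq_tp_z le_zx le_zy.
by move: eq_x eq_y; rewrite !eqxx => /esym/eqP<- /esym/eqP<-.
Qed.

Lemma tp_mark2_dist_determined t T (C : finType) h (c : X -> C) x y x' y' :
  1 < t -> refine_threshold t (C * bool * bool)%type h <= T ->
  tp T (mark c x) h x = tp T (mark c x') h x' ->
  tp T (mark c y) h y = tp T (mark c y') h y' ->
  rho x y <= h -> rho x y = rho x' y' ->
  tp t (mark (mark c y) x) h x = tp t (mark (mark c y') x') h x'.
Proof.
move=> t_gt1 leT eq_x eq_y le_xy eq_dist; have t_gt0 := ltnW t_gt1.
have le_yx : rho y x <= h by rewrite udistC.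
have [x'' le_yx'' eq_x''] := tp_mark_forth t_gt1 leT eq_y le_yx.
have le_yy : rho y y <= h by rewrite udistxx.
have dist_x'' := udist_mark2 t_gt1 eq_x'' le_yx le_yy.
have le_x''y : rho x'' y' <= h by rewrite udistC.
rewrite (tp_same_ball t _ le_xy) eq_x'' -(tp_same_ball t _ le_x''y).
apply: tp_mark2_swap => //; first by rewrite -dist_x''.
rewrite -(tp_coarsen t_gt0 leT eq_x).
rewrite (tp_same_ball t _ le_xy) (tp_same_ball t _ le_x''y).
by apply/esym; apply: (tp_recolour (phi := fun k => (k.1.1, k.2)) _ _ eq_x'').
Qed.

End Types.

(** * Types determine formulas *)

Section Determination.

Variables (X : finType) (rho : ultrametric X) (C : Type) (c : X -> C).

Definition colour_determined (P : pred X) :=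
  forall x x', c x = c x' -> P x = P x'.

Definition dist_determined (P : rel X) :=
  forall x y x' y', c x = c x' -> c y = c y' -> rho x y = rho x' y' ->
  P x y = P x' y'.

End Determination.

Definition dist_determined_structure (U B : Type) (A : structure U B)
    (rho : ultrametric A) (C : Type) (c : A -> C) :=
  (forall P, colour_determined c (@un U B A P)) /\
  (forall R, dist_determined rho c (@bi U B A R)).

Definition bounded_by (X : finType) D (rho : ultrametric X) :=
  forall x y, rho x y <= D.

Lemma eq_quant_bisim (T : finType) (P Q : pred T) :
  (forall x, exists y, P x = Q y) -> (forall y, exists x, Q y = P x) ->
  [exists x, P x] = [exists y, Q y] /\ [forall x, P x] = [forall y, Q y].
Proof.
move=> PQ QP; split.
  apply/existsP/existsP => -[x]; first by have [y ->] := PQ x; exists y.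
  by have [y ->] := QP x; exists y.
apply/forallP/forallP => all_true x; first by have [y ->] := QP x.
by have [y ->] := PQ x.
Qed.

Definition env_colour_type (C : finType) n s : finType :=
  (C * {ffun 'I_n -> bool} * {ffun 'I_s -> bool})%type.

Fixpoint modulus U B n s (phi : cmso U B n s) : nat :=
  match phi with
  | FMod _ _ b _ _ => b
  | FNot _ _ f => modulus f
  | FAnd _ _ f g => lcmn (modulus f) (modulus g)
  | FOr _ _ f g => lcmn (modulus f) (modulus g)
  | FExElt _ _ f => modulus f
  | FAllElt _ _ f => modulus f
  | FExSet _ _ f => modulus f
  | FAllSet _ _ f => modulus f
  | _ => 1
  end.

Lemma modulus_gt0 U B n s (phi : cmso U B n s) : 0 < modulus phi.
Proof.
elim: phi => //= => [? ? b a _|? ? f IHf g IHg|? ? f IHf g IHg].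
- exact: leq_trans (ltn_ord a).
- by rewrite lcmn_gt0 IHf.
- by rewrite lcmn_gt0 IHf.
Qed.

Section Evaluation.

Variables (U B : Type) (C : finType) (M D : nat).

Definition quant_threshold t n s :=
  refine_threshold M t (env_colour_type C n s * bool)%type D.

Fixpoint threshold n s (phi : cmso U B n s) : nat :=
  match phi with
  | FNot _ _ f => threshold f
  | FAnd _ _ f g => maxn (threshold f) (threshold g)
  | FOr _ _ f g => maxn (threshold f) (threshold g)
  | FExElt n s f => quant_threshold (threshold f) n s
  | FAllElt n s f => quant_threshold (threshold f) n s
  | FExSet n s f => quant_threshold (threshold f) n s
  | FAllSet n s f => quant_threshold (threshold f) n s
  | _ => 2
  end.

Lemma threshold_gt1 n s (phi : cmso U B n s) : 1 < threshold phi.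
Proof.
by elim: phi => //= ? ? f IHf g _; rewrite leq_max IHf.
Qed.

Variables (A : structure U B) (rho : ultrametric A) (c : A -> C).
Hypothesis rho_bounded : bounded_by D rho.
Hypothesis A_determined : dist_determined_structure rho c.

Definition env_colour n s (e : 'I_n -> A) (E : 'I_s -> {set A}) (x : A) :
    env_colour_type C n s :=
  (c x, [ffun i => e i == x], [ffun j => x \in E j]).

Definition push_elt n s (k : env_colour_type C n s * bool) :
    env_colour_type C n.+1 s :=
  (k.1.1.1, [ffun i => vcons k.2 k.1.1.2 i], k.1.2).

Definition push_set n s (k : env_colour_type C n s * bool) :
    env_colour_type C n s.+1 :=
  (k.1.1, [ffun j => vcons k.2 k.1.2 j]).

Lemma env_colour_elt n s (e : 'I_n -> A) (E : 'I_s -> {set A}) a :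
  env_colour (vcons a e) E =1 @push_elt n s \o mark (env_colour e E) a.
Proof.
move=> x; congr (_, _, _); apply/ffunP => i; rewrite !ffunE.
by rewrite /vcons; case: (unlift ord0 i) => //= j; rewrite ffunE.
Qed.

Lemma env_colour_set n s (e : 'I_n -> A) (E : 'I_s -> {set A}) Y :
  env_colour e (vcons Y E)
  =1 @push_set n s \o (fun x => (env_colour e E x, x \in Y)).
Proof.
move=> x; congr (_, _, _); apply/ffunP => i; rewrite !ffunE.
by rewrite /vcons; case: (unlift ord0 i) => //= j; rewrite ffunE.
Qed.

(* Every ball of radius [D] is the whole structure, so the choice of a base
   point is irrelevant. *)
Variable x0 : A.

Definition env_tp t n s (e : 'I_n -> A) (E : 'I_s -> {set A}) :=
  tp rho M t (env_colour e E) D x0.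

Lemma env_tp_pair t n s (e e' : 'I_n -> A) (E E' : 'I_s -> {set A}) i j :
  1 < t -> env_tp t e E = env_tp t e' E' ->
  [/\ env_colour e E (e i) = env_colour e' E' (e' i),
      env_colour e E (e j) = env_colour e' E' (e' j)
    & rho (e i) (e j) = rho (e' i) (e' j)].
Proof.
move=> t_gt1 eq_tp_e.
have [yi [yj [eq_i eq_j eq_dist]]] :=
  tp_pair t_gt1 eq_tp_e (rho_bounded x0 (e i)) (rho_bounded x0 (e j)).
have value_uniq l y : env_colour e E (e l) = env_colour e' E' y -> y = e' l.
  by case=> _ /ffunP/(_ l); rewrite !ffunE eqxx => /esym/eqP.
by rewrite -(value_uniq i yi eq_i) -(value_uniq j yj eq_j).
Qed.

Lemma env_tp_card t n s (e e' : 'I_n -> A) (E E' : 'I_s -> {set A}) j :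
  env_tp t e E = env_tp t e' E' -> #|E j| = #|E' j| %[mod M.+1].
Proof.
move=> eq_tp_e.
have cardE (e1 : 'I_n -> A) (E1 : 'I_s -> {set A}) :
    #|E1 j|
    = type_card (fun k : env_colour_type C n s => k.2 j) (env_tp t e1 E1)
      %[mod M.+1].
  rewrite -card_tp; congr (_ %% _); apply: eq_card => y.
  by rewrite !inE rho_bounded ffunE.
by rewrite (cardE e E) eq_tp_e -cardE.
Qed.

Section Forth.

Variables (t T n s : nat).
Hypotheses (t_gt1 : 1 < t) (leT : quant_threshold t n s <= T).
Variables (e e' : 'I_n -> A) (E E' : 'I_s -> {set A}).
Hypothesis eq_env_tp : env_tp T e E = env_tp T e' E'.

Lemma env_tp_forth_set Y :
  exists Y', env_tp t e (vcons Y E) = env_tp t e' (vcons Y' E').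
Proof.
have [f' eq_f'] := tp_refine (fun y => y \in Y) (ltnW t_gt1) leT eq_env_tp.
exists [set y | f' y].
apply: tp_recolour eq_f' => y; first exact: env_colour_set.
by rewrite env_colour_set /= inE.
Qed.

Lemma env_tp_forth_elt a :
  exists a', env_tp t (vcons a e) E = env_tp t (vcons a' e') E'.
Proof.
have [a' _ eq_a] := tp_mark_forth t_gt1 leT eq_env_tp (rho_bounded x0 a).
by exists a'; apply: tp_recolour eq_a; apply: env_colour_elt.
Qed.

End Forth.

Definition tp_determined t n s (phi : cmso U B n s) :=
  forall e e' E E',
  env_tp t e E = env_tp t e' E' -> eval phi e E = eval phi e' E'.

Lemma tp_determined_elt t T n s (f : cmso U B n.+1 s) :
  1 < t -> quant_threshold t n s <= T -> tp_determined t f ->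
  tp_determined T (FExElt f) /\ tp_determined T (FAllElt f).
Proof.
move=> t_gt1 leT f_det.
have forth e e' E E' (eq_e : env_tp T e E = env_tp T e' E') a :
    exists a', eval f (vcons a e) E = eval f (vcons a' e') E'.
  by have [a' /f_det] := env_tp_forth_elt t_gt1 leT eq_e a; exists a'.
by split=> e e' E E' eq_e /=;
  have [] := eq_quant_bisim (forth _ _ _ _ eq_e) (forth _ _ _ _ (esym eq_e)).
Qed.

Lemma tp_determined_set t T n s (f : cmso U B n s.+1) :
  1 < t -> quant_threshold t n s <= T -> tp_determined t f ->
  tp_determined T (FExSet f) /\ tp_determined T (FAllSet f).
Proof.
move=> t_gt1 leT f_det.
have forth e e' E E' (eq_e : env_tp T e E = env_tp T e' E') Y :
    exists Y', eval f e (vcons Y E) = eval f e' (vcons Y' E').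
  by have [Y' /f_det] := env_tp_forth_set t_gt1 leT eq_e Y; exists Y'.
by split=> e e' E E' eq_e /=;
  have [] := eq_quant_bisim (forth _ _ _ _ eq_e) (forth _ _ _ _ (esym eq_e)).
Qed.

Lemma eval_tp_determined n s (phi : cmso U B n s) t :
  modulus phi %| M.+1 -> threshold phi <= t -> tp_determined t phi.
Proof.
case: A_determined => un_det bi_det.
elim: phi t => {n s} /=.
- move=> n s i j t _ t_gt1 e e' E E' eq_e /=.
  have [_ _ eq_dist] := env_tp_pair i j t_gt1 eq_e.
  by rewrite -!(udist_eq0 rho) eq_dist.
- move=> n s i j t _ t_gt1 e e' E E' eq_e /=.
  have [[_ _ /ffunP eq_mem] _ _] := env_tp_pair i i t_gt1 eq_e.
  by have := eq_mem j; rewrite !ffunE.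
- move=> n s P i t _ t_gt1 e e' E E' eq_e /=.
  have [[eq_c _ _] _ _] := env_tp_pair i i t_gt1 eq_e.
  exact: un_det.
- move=> n s R i j t _ t_gt1 e e' E E' eq_e /=.
  have [[eq_ci _ _] [eq_cj _ _] eq_dist] := env_tp_pair i j t_gt1 eq_e.
  exact: bi_det.
- move=> n s b a j t dvd_bM _ e e' E E' /(env_tp_card j) eq_mod /=.
  by rewrite -(modn_dvdm _ dvd_bM) eq_mod modn_dvdm.
- move=> n s f IH t dvdM le_t e e' E E' eq_e /=; congr (~~ _).
  exact: IH eq_e.
- move=> n s f IHf g IHg t; rewrite dvdn_lcm geq_max => /andP[? ?] /andP[? ?].
  move=> e e' E E' eq_e.
  by congr (andb _ _); [apply: IHf eq_e | apply: IHg eq_e].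
- move=> n s f IHf g IHg t; rewrite dvdn_lcm geq_max => /andP[? ?] /andP[? ?].
  move=> e e' E E' eq_e.
  by congr (orb _ _); [apply: IHf eq_e | apply: IHg eq_e].
- move=> n s f IH t dvdM leT.
  by case: (tp_determined_elt (threshold_gt1 f) leT (IH _ dvdM (leqnn _))).
- move=> n s f IH t dvdM leT.
  by case: (tp_determined_elt (threshold_gt1 f) leT (IH _ dvdM (leqnn _))).
- move=> n s f IH t dvdM leT.
  by case: (tp_determined_set (threshold_gt1 f) leT (IH _ dvdM (leqnn _))).
- move=> n s f IH t dvdM leT.
  by case: (tp_determined_set (threshold_gt1 f) leT (IH _ dvdM (leqnn _))).
Qed.

End Evaluation.

Theorem binary_query_dist_determined (U B : Type) (C : finType) D
    (mu : cmso U B 2 0) :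
  exists F : finType,
  forall (A : structure U B) (rho : ultrametric A) (c : A -> C),
    bounded_by D rho -> dist_determined_structure rho c ->
  exists c' : A -> F, dist_determined rho c' (@holds2 U B A mu).
Proof.
pose M := (modulus mu).-1; pose t := threshold C M D mu.
pose T := refine_threshold M t (C * bool * bool)%type D.
exists (ball_type M T (C * bool)%type D) => A rho c rho_bounded A_det.
exists (fun x => tp rho M T (mark c x) D x) => x y x' y' eq_x eq_y eq_dist.
have := tp_mark2_dist_determined (threshold_gt1 C M D mu) (leqnn T) eq_x eq_y
  (rho_bounded x y) eq_dist.
rewrite -/t [RHS](tp_same_ball M t _ (rho_bounded x' x)) => eq_mark2.
apply: (eval_tp_determined rho_bounded A_det (x0 := x) (M := M) (t := t)) => //.
  by rewrite prednK ?modulus_gt0.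
pose to_env (k : C * bool * bool) : env_colour_type C 2 0 :=
  (k.1.1, [ffun i => vcons k.2 (vcons k.1.2 vnil) i], [ffun _ => false]).
have to_envE a b : env_colour c (vcons a (vcons b vnil)) vnil
    =1 to_env \o mark (mark c b) a.
  move=> w; congr (_, _, _); apply/ffunP => i; rewrite !ffunE; last by case: i.
  rewrite /vcons; case: (unlift ord0 i) => //= j.
  by case: (unlift ord0 j) => //= -[].
exact: tp_recolour (to_envE x y) (to_envE x' y') eq_mark2.
Qed.

(** * Rooted trees *)

Section Ancestors.

Variable T : rtree.
Implicit Types x y z r : T.

Definition up n x : option T := iter n (obind (@parent T)) (Some x).

Definition at_depth n x := oapp (@is_root T) false (up n x).

Lemma upD m n x : up (m + n) x = obind (up m) (up n x).
Proof.
rewrite /up iterD; case: (iter n _ _) => //=.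
by elim: m => //= m ->.
Qed.

Lemma at_depthP n x :
  reflect (exists2 r, up n x = Some r & is_root r) (at_depth n x).
Proof.
rewrite /at_depth; case: (up n x) => [r|] /=; last by constructor=> -[].
by apply: (iffP idP) => [|[_ [<-]]] //; exists r.
Qed.

Lemma up_root n r : is_root r -> up n.+1 r = None.
Proof. by move/eqP=> root_r; rewrite -addn1 upD /= root_r. Qed.

Lemma up_neq_None n m x : at_depth n x -> (up m x != None) = (m <= n).
Proof.
move=> /at_depthP[r up_x root_r]; have [le_mn|lt_nm] := leqP m n.
  by move: up_x; rewrite -(subnK le_mn) upD; case: (up m x).
by rewrite -(subnK lt_nm) -addSnnS upD up_x [obind _ _]up_root.
Qed.

Lemma at_depth_uniq n m x : at_depth n x -> at_depth m x -> n = m.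
Proof.
move=> depth_n depth_m; apply/eqP; rewrite eqn_leq.
rewrite -(up_neq_None n depth_m) -(up_neq_None m depth_n).
by case/at_depthP: depth_n => ? ->; case/at_depthP: depth_m => ? ->.
Qed.

Lemma at_depth_up n m x z : at_depth n x -> up m x = Some z ->
  m <= n /\ at_depth (n - m) z.
Proof.
move=> depth_x up_x.
have le_mn : m <= n by rewrite -(up_neq_None _ depth_x) up_x.
by split=> //; move: depth_x; rewrite /at_depth -{1}(subnK le_mn) upD up_x.
Qed.

Lemma up_exists n m x : at_depth n x -> m <= n ->
  exists2 z, up m x = Some z & at_depth (n - m) z.
Proof.
move=> depth_x; rewrite -(up_neq_None _ depth_x).
case up_x: (up m x) => [z|] // _; exists z => //.
by have [] := at_depth_up depth_x up_x.
Qed.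

Lemma is_root_uniq r s : is_root r -> is_root s -> r = s.
Proof. by move=> /eqP root_r /eqP; apply: root_unique. Qed.

Lemma up_same_depth n x y : at_depth n x -> at_depth n y -> up n x = up n y.
Proof.
move=> /at_depthP[r -> root_r] /at_depthP[s -> root_s].
by rewrite (is_root_uniq root_r root_s).
Qed.

Lemma descendant_up x y : descendant x y <-> exists n, up n y = Some x.
Proof.
split=> [/connectP[p]|[n]].
  elim: p x => [|z p IH] x /=; first by move=> _ ->; exists 0.
  move=> /andP[/eqP parent_z path_z] /(IH z path_z)[n up_y].
  by exists n.+1; rewrite -add1n upD up_y.
elim: n x => [|n IH] x; first by case=> ->; apply: connect0.
rewrite -add1n upD; case up_y: (up n y) => [z|] //= parent_z.
by apply: connect_trans (IH z up_y); apply/connect1/eqP.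
Qed.

Lemma exists_depth x : exists n, at_depth n x.
Proof.
have [r root_r /descendant_up[n up_x]] := root_reach x.
by exists n; apply/at_depthP; exists r => //; apply/eqP.
Qed.

Lemma up_path n x z : up n x = Some z ->
  (exists p, [/\ path (@tadj T) x p, last x p = z & size p = n]) /\
  (exists p, [/\ path (@tadj T) z p, last z p = x & size p = n]).
Proof.
elim: n z => [|n IH] z; first by case=> ->; split; exists [::].
rewrite -add1n upD; case up_x: (up n x) => [y|] //= parent_y.
have adj_zy : tadj z y by rewrite /tadj /child parent_y eqxx.
have adj_yz : tadj y z by rewrite /tadj orbC.
have [[p [path_p last_p size_p]] [q [path_q last_q size_q]]] := IH y up_x.
split; last by exists (y :: q); rewrite /= path_q last_q size_q adj_zy.
exists (rcons p z); rewrite rcons_path last_rcons size_rcons.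
by rewrite path_p last_p size_p adj_yz.
Qed.

(* [z] is the topmost node of the path. *)
Lemma path_common_ancestor x p : path (@tadj T) x p ->
  exists i j z,
  [/\ i + j <= size p, up i x = Some z & up j (last x p) = Some z].
Proof.
elim/last_ind: p => [|p w IH] /=; first by exists 0, 0, x.
rewrite rcons_path last_rcons size_rcons => /andP[/IH].
move=> [i [j [z [le_ij up_x up_y]]]] /orP[/eqP parent_w|/eqP parent_y].
  exists i, j.+1, z; split=> //; first by rewrite addnS.
  by rewrite -addn1 upD /= parent_w.
case: j up_y le_ij => [[last_p] le_ij|j up_y le_ij].
  exists i.+1, 0, w; split=> //.
  by rewrite -add1n upD up_x /= -last_p.
exists i, j, z; split=> //; first by lia.
by move: up_y; rewrite -addn1 upD /= parent_y.
Qed.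

Lemma tdist_uniq x y n m : tdist x y n -> tdist x y m -> n = m.
Proof.
move=> [[p [path_p last_p size_p]] min_n] [[q [path_q last_q size_q]] min_m].
by apply/eqP; rewrite eqn_leq -{1}size_q min_n // -size_p min_m.
Qed.

Lemma tdist_common_ancestor i j x y z :
  up i x = Some z -> up j y = Some z ->
  (forall i' j' w, up i' x = Some w -> up j' y = Some w -> i + j <= i' + j') ->
  tdist x y (i + j).
Proof.
move=> /up_path[[p [path_p last_p size_p]] _].
move=> /up_path[_ [q [path_q last_q size_q]]] min_ij; split.
  exists (p ++ q); rewrite cat_path last_cat size_cat.
  by rewrite last_p path_p path_q last_q size_p size_q.
move=> s /path_common_ancestor[i' [j' [w [le_s up_x up_y]]]] last_s.
by rewrite last_s in up_y; apply: leq_trans (min_ij _ _ _ up_x up_y) le_s.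
Qed.

Lemma tdist_rootP r x n : is_root r -> tdist r x n <-> at_depth n x.
Proof.
move=> root_r; have tdist_depth m : at_depth m x -> tdist r x m.
  move=> depth_x; have /at_depthP[s up_x root_s] := depth_x.
  rewrite (is_root_uniq root_r root_s).
  apply: (tdist_common_ancestor (i := 0) _ up_x) => // -[|i] j w; last first.
    by rewrite up_root.
  case=> <- up_j; suff -> : m = j by [].
  by apply: at_depth_uniq depth_x _; apply/at_depthP; exists s.
split=> [|/tdist_depth//]; have [m depth_x] := exists_depth x.
by move/(tdist_uniq (tdist_depth m depth_x)) <-.
Qed.

Lemma tdist_same_depth n l x y : at_depth n x -> at_depth n y ->
  (forall i, (up i x == up i y) = (l <= i)) -> tdist x y (2 * l).
Proof.
move=> depth_x depth_y up_eq.
have eq_up : up l x = up l y by apply/eqP; rewrite up_eq.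
have le_ln : l <= n by rewrite -up_eq (up_same_depth depth_x depth_y).
have [z up_x _] := up_exists depth_x le_ln.
rewrite mul2n -addnn; apply: (tdist_common_ancestor up_x).
  by rewrite -eq_up.
move=> i j w up_i up_j.
have [le_i depth_i] := at_depth_up depth_x up_i.
have [le_j depth_j] := at_depth_up depth_y up_j.
have eq_ij : i = j by have := at_depth_uniq depth_i depth_j; lia.
by rewrite -eq_ij leq_add // -up_eq up_i eq_ij up_j.
Qed.

End Ancestors.

(** * Copied tree-models as ultrametrics *)

Lemma filtration_ultrametric (X : finType) (L : eqType) (R : nat -> X -> L) D :
    injective (R 0) -> (forall h x y, R h x = R h y -> R h.+1 x = R h.+1 y) ->
    (forall x y, R D x = R D y) ->
  exists rho : ultrametric X, forall h x y, (rho x y <= h) = (R h x == R h y).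
Proof.
move=> R0_inj R_step R_top.
have ex_join x y : exists h, R h x == R h y by exists D; apply/eqP.
pose join x y := ex_minn (ex_join x y).
have join_leq h x y : (join x y <= h) = (R h x == R h y).
  rewrite /join; case: ex_minnP => l /eqP eq_l min_l.
  apply/idP/idP => [|/min_l//].
  move=> /subnKC<-; elim: (h - l) => [|j /eqP IH]; first by rewrite addn0 eq_l.
  by rewrite addnS; apply/eqP/R_step.
have join_eq0 x y : (join x y == 0) = (x == y).
  by rewrite -leqn0 join_leq (inj_eq R0_inj).
have joinC x y : join x y = join y x.
  have join_le u v : join u v <= join v u by rewrite join_leq eq_sym -join_leq.
  by apply/eqP; rewrite eqn_leq !join_le.
have join_ultra y x z : join x z <= maxn (join x y) (join y z).
  rewrite join_leq; set h := maxn _ _.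
  have /eqP-> : R h x == R h y by rewrite -join_leq leq_maxl.
  by rewrite -join_leq leq_maxr.
by exists (Ultrametric join_eq0 joinC join_ultra).
Qed.

Definition ultrametric_model D m k (G : sgraph) :=
  exists (rho : ultrametric G) (c : G -> 'I_m),
  [/\ bounded_by D rho, forall x, #|ball rho 1 x| <= k
    & dist_determined rho c (@edge G)].

Lemma TMC_ultrametric_model d m k G :
  TMC d m k G -> ultrametric_model d.+1 m k G.
Proof.
case=> model few_leaves; set T := tm_tree model.
pose leaf : G -> T := @tm_leaf _ _ _ model; pose colour := @tm_col _ _ _ model.
have is_leafE v : is_leaf (leaf v) by apply/tm_leaf_im; exists v.
have depth v : at_depth d.+1 (leaf v).
  have [n depth_v] := exists_depth (leaf v).
  have /at_depthP[r _ root_r] := depth_v.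
  by apply/(tdist_rootP _ _ root_r)/tm_depth.
have [||u v|rho rhoE] :=
  @filtration_ultrametric _ _ (fun h v => up h (leaf v)) d.+1.
- by move=> u v [] /tm_leaf_inj.
- by move=> h u v eq_up; rewrite -add1n upD eq_up -upD.
- exact: up_same_depth.
exists rho, colour; split.
- by move=> u v; rewrite rhoE (up_same_depth (depth u) (depth v)).
- move=> v; have [b up_v] := up_exists (depth v) (ltn0Sn d).
  rewrite subn1 /= => depth_b.
  have /at_depthP[r _ root_r] := depth_b.
  apply: leq_trans (few_leaves r b root_r _); last exact/tdist_rootP.
  rewrite -(card_imset _ (@tm_leaf_inj _ _ _ model)); apply: subset_leq_card.
  apply/subsetP => y /imsetP[u]; rewrite !inE rhoE => /eqP eq_up ->.
  by rewrite is_leafE /=; apply/descendant_up; exists 1; rewrite -up_v eq_up.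
have edgeE u v :
    edge u v = (u != v) && @tm_sig _ _ _ model (colour u) (colour v) (rho u v).
  have [->|neq_uv] := eqVneq u v; first by rewrite edge_irrefl.
  apply: tm_edge neq_uv (tdist_same_depth (depth u) (depth v) _) => i.
  by rewrite rhoE.
move=> u v u' v' eq_u eq_v eq_dist.
by rewrite !edgeE eq_u eq_v eq_dist -!(udist_eq0 rho) eq_dist.
Qed.

Section BallTree.

Variables (X : finType) (rho : ultrametric X) (D : nat).
Hypothesis rho_bounded : bounded_by D rho.

Definition ball_node := {p : 'I_D.+1 * X | center rho p.1 p.2 == p.2}.

Definition node_of h x : ball_node :=
  exist _ (inord h, center rho (inord h : 'I_D.+1) x)
    (introT eqP (center_id _ _ _)).

Lemma node_ofP (p : ball_node) : exists h x, h <= D /\ p = node_of h x.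
Proof.
case: p => [[h x] center_x]; exists h, x; split; first by rewrite -ltnS.
by apply/val_inj; rewrite /= inord_val (eqP center_x).
Qed.

Lemma node_of_eq h l x y : h <= D -> l <= D ->
  (node_of h x == node_of l y) = (h == l) && (rho x y <= h).
Proof.
move=> le_h le_l; rewrite -val_eqE /= xpair_eqE -val_eqE /= !inordK //.
by case: eqP => //= <-; apply: center_eq.
Qed.

Definition ball_parent (p : ball_node) : option ball_node :=
  if (val p).1 == D :> nat then None else Some (node_of (val p).1.+1 (val p).2).

Lemma ball_parent_top x : ball_parent (node_of D x) = None.
Proof. by rewrite /ball_parent /= inordK ?eqxx. Qed.

Lemma ball_parent_node h x : h < D ->
  ball_parent (node_of h x) = Some (node_of h.+1 x).
Proof.
move=> lt_hD; rewrite /ball_parent /= inordK ?ltnS 1?ltnW // (ltn_eqF lt_hD).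
by congr Some; apply/eqP; rewrite node_of_eq // eqxx udistC leqW ?center_in.
Qed.

Lemma ball_parent_None p : ball_parent p = None -> exists x, p = node_of D x.
Proof.
have [h [x [le_hD ->]]] := node_ofP p.
move: le_hD; rewrite leq_eqVlt => /predU1P[->|lt_hD]; first by exists x.
by rewrite ball_parent_node.
Qed.

Lemma ball_root_unique p q :
  ball_parent p = None -> ball_parent q = None -> p = q.
Proof.
move=> /ball_parent_None[x ->] /ball_parent_None[y ->].
by apply/eqP; rewrite node_of_eq // eqxx rho_bounded.
Qed.

Lemma ball_root_reach p : exists2 q, ball_parent q = None &
  connect (fun y z => ball_parent z == Some y) q p.
Proof.
have [h [x [le_hD ->]]] := node_ofP p.
exists (node_of D x); first exact: ball_parent_top.
have [j eq_D] : exists j, h + j = D by exists (D - h); rewrite subnKC.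
elim: j h {p le_hD} eq_D => [|j IH] h; first by rewrite addn0 => ->.
rewrite -addSnnS => eq_D; apply: connect_trans (IH _ eq_D) (connect1 _).
by rewrite ball_parent_node //; lia.
Qed.

Definition ball_tree : rtree := RTree ball_root_unique ball_root_reach.

Definition ball_tree_node h x : ball_tree := node_of h x.

Lemma up_ball_tree n h x : h + n <= D ->
  up n (ball_tree_node h x) = Some (ball_tree_node (h + n) x).
Proof.
elim: n => [|n IH] le_D; first by rewrite addn0.
rewrite -[n.+1]add1n upD IH ?addnS /=; last by lia.
by rewrite ball_parent_node //; lia.
Qed.

Lemma ball_tree_depth h x : h <= D -> at_depth (D - h) (ball_tree_node h x).
Proof.
move=> le_hD; apply/at_depthP; exists (ball_tree_node D x).
  by rewrite up_ball_tree subnKC.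
by apply/eqP/ball_parent_top.
Qed.

Lemma is_leaf_ball_tree h x : h <= D -> is_leaf (ball_tree_node h x) = (h == 0).
Proof.
move=> le_hD; apply/forallP/eqP => [leaf_h|-> p].
  case: h le_hD leaf_h => // h le_hD /(_ (node_of h x)).
  by rewrite /child /= ball_parent_node ?eqxx.
have [l [y [le_lD ->]]] := node_ofP p; rewrite /child /=.
move: le_lD; rewrite leq_eqVlt => /predU1P[->|lt_lD].
  by rewrite ball_parent_top.
by rewrite ball_parent_node //; apply/eqP => /Some_inj/eqP; rewrite node_of_eq.
Qed.

Definition ball_tree_leaf x := ball_tree_node 0 x.

Lemma ball_tree_leaf_inj : injective ball_tree_leaf.
Proof. by move=> x y /eqP; rewrite node_of_eq // leqn0 udist_eq0 => /eqP. Qed.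

Lemma ball_tree_leafP (p : ball_tree) :
  is_leaf p <-> exists x, ball_tree_leaf x = p.
Proof.
split=> [|[x <-]]; last by rewrite is_leaf_ball_tree.
have [h [x [le_hD ->]]] := node_ofP p.
by rewrite is_leaf_ball_tree // => /eqP->; exists x.
Qed.

Lemma ball_tree_leaf_depth x : at_depth D (ball_tree_leaf x).
Proof. by have := ball_tree_depth x (leq0n D); rewrite subn0. Qed.

Lemma up_ball_tree_leaf i x y :
  (up i (ball_tree_leaf x) == up i (ball_tree_leaf y)) = (rho x y <= i).
Proof.
have [le_iD|lt_Di] := leqP i D.
  by rewrite !up_ball_tree // !add0n (inj_eq Some_inj) node_of_eq // eqxx.
have up_None z : up i (ball_tree_leaf z) = None.
  apply/eqP; rewrite -[_ == _]negbK (up_neq_None _ (ball_tree_leaf_depth z)).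
  by rewrite -ltnNge.
by rewrite !up_None eqxx (leq_trans (rho_bounded x y)) // ltnW.
Qed.

Lemma tdist_ball_tree_leaf x y :
  tdist (ball_tree_leaf x) (ball_tree_leaf y) (2 * rho x y).
Proof.
apply: tdist_same_depth (ball_tree_leaf_depth x) (ball_tree_leaf_depth y) _.
by move=> i; apply: up_ball_tree_leaf.
Qed.

Lemma descendant_ball_tree_leaf h x y : h <= D ->
  descendant (ball_tree_node h x) (ball_tree_leaf y) -> rho x y <= h.
Proof.
move=> le_hD /descendant_up[n up_y].
have le_nD : n <= D by rewrite -(up_neq_None _ (ball_tree_leaf_depth y)) up_y.
move: up_y; rewrite up_ball_tree // add0n => /Some_inj/eqP.
by rewrite node_of_eq // udistC => /andP[/eqP->].
Qed.

End BallTree.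

Lemma ultrametric_model_TMC d m k G :
  ultrametric_model d.+1 m k G -> TMC d m k G.
Proof.
case=> rho [c [rho_bounded small_balls edge_det]].
pose T := ball_tree rho_bounded.
pose leaf : G -> T := ball_tree_leaf rho_bounded.
pose sig i j l :=
  [exists u, exists v, [&& rho u v == l, c u == i, c v == j & edge u v]].
have depth (r x : T) : is_root r -> is_leaf x -> tdist r x d.+1.
  move=> root_r /ball_tree_leafP[v <-].
  exact/tdist_rootP/ball_tree_leaf_depth.
have sig_range i j l : sig i j l -> 1 <= l <= d.+1.
  case/existsP => u /existsP[v /and4P[/eqP<- _ _ edge_uv]].
  rewrite rho_bounded andbT lt0n udist_eq0.
  by apply: contraTneq edge_uv => ->; rewrite edge_irrefl.
have sig_sym i j l : sig i j l = sig j i l.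
  by apply/existsP/existsP => -[u /existsP[v /and4P[dist_uv c_u c_v edge_uv]]];
    exists v; apply/existsP; exists u; rewrite udistC edge_sym; apply/and4P.
have sig_edge (u v : G) l : u != v -> tdist (leaf u) (leaf v) (2 * l) ->
    edge u v = sig (c u) (c v) l.
  move=> _ /(tdist_uniq (tdist_ball_tree_leaf rho_bounded u v)) eq_l.
  have {eq_l} <- : rho u v = l by lia.
  apply/idP/existsP => [edge_uv|[u' /existsP[v']]].
    by exists u; apply/existsP; exists v; rewrite !eqxx.
  by case/and4P => /eqP eq_dist /eqP eq_u /eqP eq_v; rewrite (edge_det _ _ u v).
exists (TreeModel depth (@ball_tree_leaf_inj _ _ _ _) (@ball_tree_leafP _ _ _ _)
  sig_range sig_sym sig_edge) => r x root_r.
move=> /(tdist_rootP _ _ root_r); have [h [v [le_h ->]]] := node_ofP x.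
move=> /(at_depth_uniq (ball_tree_depth rho_bounded v le_h)) eq_d.
have {eq_d} eq_h1 : h = 1 by lia.
rewrite {}eq_h1 in le_h *; apply: leq_trans (small_balls v).
rewrite -(card_imset _ (@ball_tree_leaf_inj _ _ _ rho_bounded)).
apply: subset_leq_card; apply/subsetP => y; rewrite inE.
move=> /andP[/ball_tree_leafP[u <-]] /(descendant_ball_tree_leaf le_h) le_uv.
by apply/imsetP; exists u; rewrite ?inE.
Qed.

(** * Transductions *)

Section Lift.

Variables (X Y : finType) (rho : ultrametric X) (f : Y -> X).

Definition lift_dist x y := if x == y then 0 else maxn 1 (rho (f x) (f y)).

Lemma lift_dist_eq0 x y : (lift_dist x y == 0) = (x == y).
Proof.
by rewrite /lift_dist; case: (eqVneq x y) => // _; rewrite -leqn0 geq_max.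
Qed.

Lemma lift_distC x y : lift_dist x y = lift_dist y x.
Proof. by rewrite /lift_dist eq_sym udistC. Qed.

Lemma lift_dist_ultra y x z :
  lift_dist x z <= maxn (lift_dist x y) (lift_dist y z).
Proof.
rewrite /lift_dist; have [//|neq_xz] := eqVneq x z.
have [<-|_] := eqVneq x y; first by rewrite (negbTE neq_xz) max0n.
have [->|_] := eqVneq y z; first by rewrite maxn0.
by have := udist_ultra rho (f y) (f x) (f z); lia.
Qed.

Definition lift_ultrametric :=
  Ultrametric lift_dist_eq0 lift_distC lift_dist_ultra.

Lemma lift_dist_leq h x y :
  0 < h -> (lift_dist x y <= h) = (rho (f x) (f y) <= h).
Proof.
move=> h_gt0; rewrite /lift_dist.
have [->|_] := eqVneq x y; first by rewrite udistxx.
by rewrite geq_max h_gt0.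
Qed.

Lemma lift_dist_neq x y : f x != f y -> lift_dist x y = rho (f x) (f y).
Proof.
rewrite /lift_dist => neq_f; have [eq_xy|_] := eqVneq x y.
  by rewrite eq_xy eqxx in neq_f.
by move: neq_f; rewrite -(udist_eq0 rho); lia.
Qed.

End Lift.

Lemma ball_injective_colouring (X : finType) (rho : ultrametric X) h k :
    (forall x, #|ball rho h x| <= k) ->
  exists c : X -> 'I_k, forall x y, rho x y <= h -> c x = c y -> x = y.
Proof.
move=> small_balls.
pose pts x := enum (ball rho h (center rho h x)).
have mem_pts x y : rho x y <= h -> x \in pts y.
  move=> le_xy; rewrite mem_enum inE udistC.
  exact: udist_trans le_xy (center_in rho h y).
have rank_lt x : index x (pts x) < k.
  apply: leq_trans (small_balls (center rho h x)).
  by rewrite cardE index_mem mem_pts // udistxx.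
exists (fun x => Ordinal (rank_lt x)) => x y le_xy [].
have -> : pts x = pts y.
  by congr (enum (ball _ _ _)); apply/eqP; rewrite center_eq.
by move/(congr1 (nth x (pts y))); rewrite !nth_index ?mem_pts ?udistxx.
Qed.

Lemma copy_dist_determined p K m k (G : sgraph) (Q : 'I_p -> {set G})
    (rho : ultrametric G) (c : G -> 'I_m) (bag_colour : G -> 'I_k) :
    dist_determined rho c (@edge G) ->
    (forall u v, rho u v <= 1 -> bag_colour u = bag_colour v -> u = v) ->
  dist_determined_structure (A := copy K (expand Q))
    (lift_ultrametric rho (fst : G * 'I_K -> G))
    (fun x => (c x.1, bag_colour x.1, [ffun i => x.1 \in Q i], x.2)).
Proof.
set rhoK := lift_ultrametric _ _ => edge_det bag_inj.
have same_vertex (x y : G * 'I_K) :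
    (x.1 == y.1) = (rhoK x y <= 1) && (bag_colour x.1 == bag_colour y.1).
  rewrite lift_dist_leq //; apply/eqP/andP => [->|[le_xy /eqP]].
    by rewrite udistxx.
  exact: bag_inj.
split=> [[P|i] x y|[[]|] x y x' y'].
- by move=> [_ _ /ffunP/(_ P)] /=; rewrite !ffunE.
- by move=> [_ _ _] /= ->.
- move=> [c_x bag_x _ copy_x] [c_y bag_y _ copy_y] eq_dist /=.
  rewrite copy_x copy_y; congr (_ && _).
  have eq_same : (x.1 == y.1) = (x'.1 == y'.1).
    by rewrite !same_vertex eq_dist bag_x bag_y.
  have [eq_xy|neq_xy] := eqVneq x.1 y.1.
    by move: eq_same; rewrite eq_xy eqxx => /esym/eqP->; rewrite !edge_irrefl.
  by apply: edge_det => //; rewrite -!lift_dist_neq // -eq_same.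
- move=> [_ bag_x _ _] [_ bag_y _ _] eq_dist /=.
  by rewrite !same_vertex eq_dist bag_x bag_y.
Qed.

Lemma transduction_ultrametric_model D m k (tau : transduction) : 0 < D ->
  exists m' k', forall G H, ultrametric_model D m k G -> transduces tau G H ->
  ultrametric_model D m' k' H.
Proof.
move=> D_gt0; have [F muF] := binary_query_dist_determined
  ('I_m * 'I_k * {ffun 'I_(td_p tau) -> bool} * 'I_(td_k tau))%type D
  (bt_mu (td_basic tau)).
exists #|F|, (k * td_k tau) => G H [rho [c [rho_bounded small_balls edge_det]]].
case=> Q [_ [f f_bij f_edge]].
have [bag_colour bag_inj] := ball_injective_colouring small_balls.
have lift_bounded (Y : finType) (g : Y -> G) :
    bounded_by D (lift_ultrametric rho g).
  by move=> x y; rewrite lift_dist_leq.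
have [cF mu_det] := muF _ _ _ (lift_bounded _ _)
  (copy_dist_determined (td_k tau) Q edge_det bag_inj).
pose pos v := val (f v).
have pos_inj : injective pos := inj_comp val_inj (bij_inj f_bij).
pose rhoH := lift_ultrametric rho (fst \o pos).
exists rhoH, (enum_rank \o cF \o pos); split.
- exact: lift_bounded.
- move=> v; rewrite -(card_imset _ pos_inj).
  apply: leq_trans (leq_mul (small_balls (pos v).1) (leqnn _)).
  rewrite -[X in _ * X]card_ord -cardsT -cardsX; apply: subset_leq_card.
  apply/subsetP => y /imsetP[u]; rewrite !inE lift_dist_leq // => le_vu ->.
  by rewrite le_vu.
- have dist_pos u v : lift_ultrametric rho fst (pos u) (pos v) = rhoH u v.
    by rewrite /= /lift_dist (inj_eq pos_inj).
  move=> u v u' v' /enum_rank_inj eq_u /enum_rank_inj eq_v eq_dist.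
  rewrite -!f_edge /= /basic_edge !(bij_eq f_bij) -!(udist_eq0 rhoH) eq_dist.
  by congr (_ && _); apply: mu_det; rewrite ?dist_pos.
Qed.

Theorem theorem4p7 (d : nat) (C : graph_class) (tau : transduction) :
  1 <= d -> copying_sd d C -> copying_sd_le d (image_class tau C).
Proof.
move=> _ [[m [k C_TMC]] _].
have [m' [k' tau_model]] := transduction_ultrametric_model m k tau (ltn0Sn d).
exists m', k' => H [G /C_TMC/TMC_ultrametric_model G_model G_to_H].
exact/ultrametric_model_TMC/(tau_model G H).
Qed.
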